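(* Let $\alpha=[a_0;a_1,a_2,\dots]$ be an irrational real number (with $a_0\in\mathbb{Z}$ and $a_j$ positive integers for $j\ge 1$) and let $(W_k)_{k\ge 0}$ be a sequence of positive integers with $W_k\to\infty$, such that for every $k\ge 0$ $$a_{k+1}\equiv 0 \pmod{P_{[k/2]}}\qquad\text{and}\qquad a_{k+1}\ge W_k\, P_{[k/2]+1},$$ and suppose that for some $\gamma>0$ one has $a_k\le \exp\big(\gamma k(\log k)^2\big)$ for all $k\ge 2$. Let $\eta=\lim_{k\to\infty}(b_k\alpha-c_k)$ be the real number obtained from the construction described in the context (the limit exists). Then there is a constant $c>0$ such that for every pair of integers $(q,r)$ with $\gcd(q,r)=1$ and $q>100$, $$ q\,|q\alpha-\eta-r| > c\,\frac{\sqrt{\log q}}{\log\log q}. $$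
   Context: Notation and construction. Let $p_1=2<p_2=3<p_3=5<\dots$ be the primes. Put $\Omega_0=\{(0,0)\}$ and for $k\ge1$, $\Omega_k=\{(i,j)\in\mathbb{Z}^2:\ \max(1,|i|)\cdot\max(1,|j|)\le k\}$; let $\omega_k=|\Omega_k|$ (so $\Omega_k\subset\Omega_{k+1}$). Index the primes as $p_{i,j}$, $(i,j)\in\mathbb{Z}^2$: $p_{0,0}=2$, and for each $k\ge0$ the family $(p_{i,j})_{(i,j)\in\Omega_{k+1}\setminus\Omega_k}$ is an arbitrary fixed bijective enumeration of the primes $p_s$, $\omega_k<s\le\omega_{k+1}$. Let $P_k=\prod_{(i,j)\in\Omega_k}p_{i,j}=\prod_{s=1}^{\omega_k}p_s$ and $Q_{k+1}=P_{k+1}/P_k$. For $-k\le i,j\le k$ let $A_i^{[k]}=\prod_{s:(i,s)\in\Omega_k}p_{i,s}$ and $B_j^{[k]}=\prod_{s:(s,j)\in\Omega_k}p_{s,j}$. Let $X_k,Y_k$ be the integers in $[P_k,2P_k-1]$ (given by the Chinese Remainder Theorem) with $X_k+i\equiv0\pmod{A_i^{[k]}}$ for $-k\le i\le k$ and $Y_k+j\equiv0\pmod{B_j^{[k]}}$ for $-k\le j\le k$ (so $X_0=Y_0=2$). Let $u_k/v_k=[a_0;a_1,\dots,a_k]$ be the convergents of $\alpha$ in lowest terms, with $v_{-1}=0,u_{-1}=1$, and $\mathbf e_k=(v_k,u_k)\in\mathbb{Z}^2$ for $k\ge -1$. Define the affine lattices $\mathfrak L_{2l}=\{x\mathbf e_{2l-1}+y\mathbf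 e_{2l}:\ x\equiv X_l \pmod{P_l},\ y\equiv Y_l\pmod{P_l}\}$ and $\mathfrak L_{2l+1}=\{x\mathbf e_{2l}+y\mathbf e_{2l+1}:\ x\equiv Y_{l+1}\pmod{P_{l+1}},\ y\equiv X_l\pmod{P_l}\}$. Define points $\mathfrak Z_k=(b_k,c_k)\in\mathfrak L_k$ inductively: $\mathfrak Z_0=(0,0)$, and given $\mathfrak Z_k\in\mathfrak L_k$, with $l=[k/2]$, put $\mathfrak Z_{k+1}=\mathfrak Z_k+P_l\lambda_{k+1}\mathbf e_k$, where $\lambda_{k+1}$ is a positive integer chosen so that $\mathfrak Z_{k+1}\in\mathfrak L_{k+1}$ and $\left|\lambda_{k+1}-\frac{a_{k+1}}{2P_l}\right|\le\frac{Q_{l+1}}{2}$ (such a choice exists; the admissible $\lambda_{k+1}$ form a residue class modulo $Q_{l+1}$). Finally $\eta=\lim_{k\to\infty}(b_k\alpha-c_k)=\sum_{j\ge1}P_{[(j-1)/2]}\lambda_j(v_{j-1}\alpha-u_{j-1})$. Here $[\cdot]$ is the integer part. *)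

(* Defs.v *)
From HB Require Import structures.
From mathcomp Require Import all_boot all_order all_algebra.
From mathcomp Require Import all_classical all_reals all_analysis.
Set Implicit Arguments.
Unset Strict Implicit.
Unset Printing Implicit Defensive.
Import Order.TTheory GRing.Theory Num.Theory.
Import numFieldNormedType.Exports.
Local Open Scope classical_set_scope.
Local Open Scope ring_scope.

Lemma ex_prime_gt (n : nat) : exists p, (n < p)%N && prime p.
Proof. by have [p np pp] := prime_above n; exists p; rewrite np. Qed.

(* 1-indexed: nth_prime 1 = 2, nth_prime 2 = 3, ...; nth_prime 0 = 1 is only
   the seed of the recursion. *)
Fixpoint nth_prime (s : nat) : nat :=
  if s is s'.+1 then ex_minn (ex_prime_gt (nth_prime s')) else 1%N.

Definition in_Omega (k : nat) (z : int * int) : bool :=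
  if k == 0%N then z == (0, 0)
  else (maxn 1 `|z.1| * maxn 1 `|z.2| <= k)%N.

Definition centered_range (k : nat) : seq int :=
  [seq n%:Z - k%:Z | n <- iota 0 k.*2.+1].

(* Omega_k lies in the box [-k, k]^2; see mem_Omega and Omega_uniq below. *)
Definition Omega (k : nat) : seq (int * int) :=
  [seq z <- [seq (i, j) | i <- centered_range k, j <- centered_range k]
     | in_Omega k z].

Lemma mem_centered_range (k : nat) (i : int) :
  (i \in centered_range k) = (`|i| <= k)%N.
Proof.
apply/mapP/idP => [[n + ->]|ik].
  rewrite mem_iota add0n ltnS /= => nk.
  by rewrite -lez_nat abszE ler_norml lerBrDl subrr lez_nat leq0n /= lerBlDr
             -PoszD addnn lez_nat.
move: ik; rewrite -lez_nat abszE ler_norml => /andP[i1 i2].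
have ik0 : 0 <= i + k%:Z by rewrite -lerBlDr sub0r.
exists (absz (i + k%:Z)); last by rewrite gez0_abs// addrK.
by rewrite mem_iota add0n ltnS /= -lez_nat gez0_abs// -addnn PoszD lerD2r.
Qed.

Lemma mem_Omega (k : nat) (z : int * int) : (z \in Omega k) = in_Omega k z.
Proof.
rewrite mem_filter; apply: andb_idr; case: z => i j.
rewrite /in_Omega; case: eqP => [-> /eqP -> //|_ ijk].
apply: (allpairs_f (fun i j : int => (i, j))); rewrite mem_centered_range.
- apply: leq_trans ijk; apply: (leq_trans (leq_maxr 1 _)).
  by rewrite leq_pmulr// leq_max.
- apply: leq_trans ijk; apply: (leq_trans (leq_maxr 1 _)).
  by rewrite leq_pmull// leq_max.
Qed.

Lemma Omega_uniq (k : nat) : uniq (Omega k).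
Proof.
have ur : uniq (centered_range k).
  by rewrite map_inj_uniq ?iota_uniq// => m n /addIr[].
by apply: filter_uniq; apply: allpairs_uniq => // -[? ?] [? ?].
Qed.

Definition omega (k : nat) : nat := size (Omega k).

Definition prime_indexing (p : int * int -> nat) : Prop :=
  p (0, 0) = 2%N /\
  forall k : nat,
    set_bij [set z | z \in Omega k.+1 /\ z \notin Omega k]
            [set nth_prime s | s in [set s | (omega k < s <= omega k.+1)%N]]
            p.

Section Construction.
Variable p : int * int -> nat.

Definition Pk (k : nat) : nat := (\prod_(z <- Omega k) p z)%N.

(* Only meaningful for k > 0; the division is exact since Omega_(k-1) is
   included in Omega_k. *)
Definition Qk (k : nat) : nat := (Pk k %/ Pk k.-1)%N.

Definition Ak (k : nat) (i : int) : nat :=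
  (\prod_(z <- Omega k | z.1 == i) p z)%N.

Definition Bk (k : nat) (j : int) : nat :=
  (\prod_(z <- Omega k | z.2 == j) p z)%N.

Definition crt_solutions (X Y : nat -> int) : Prop :=
  forall k : nat,
  [/\ (Pk k)%:Z <= X k <= 2 * (Pk k)%:Z - 1,
      (Pk k)%:Z <= Y k <= 2 * (Pk k)%:Z - 1,
      forall i : int, - k%:Z <= i <= k%:Z -> ((Ak k i)%:Z %| X k + i)%Z
    & forall j : int, - k%:Z <= j <= k%:Z -> ((Bk k j)%:Z %| Y k + j)%Z].

(* The finite continued fraction [a_0; a_1, ..., a_k]. *)
Fixpoint cfrac (a : nat -> int) (k : nat) : rat :=
  if k is k'.+1 then (a 0)%:~R + (cfrac (fun j => a j.+1) k')^-1
  else (a 0)%:~R.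

Definition convergent_num (a : nat -> int) (k : nat) : int := numq (cfrac a k).
Definition convergent_den (a : nat -> int) (k : nat) : int := denq (cfrac a k).

Definition evec (a : nat -> int) (k : nat) : int * int :=
  (convergent_den a k, convergent_num a k).

(* evec_pred a k is e_(k-1), with e_(-1) = (v_(-1), u_(-1)) = (0, 1). *)
Definition evec_pred (a : nat -> int) (k : nat) : int * int :=
  if k is k'.+1 then evec a k' else (0, 1).

Variables (a : nat -> int) (X Y : nat -> int).

Definition lattice_even (l : nat) : set (int * int) :=
  [set w | exists x y : int,
     [/\ (x = X l %[mod Pk l])%Z, (y = Y l %[mod Pk l])%Z
       & w = evec_pred a l.*2 *~ x + evec a l.*2 *~ y]].

Definition lattice_odd (l : nat) : set (int * int) :=
  [set w | exists x y : int,
     [/\ (x = Y l.+1 %[mod Pk l.+1])%Z, (y = X l %[mod Pk l])%Z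
       & w = evec a l.*2 *~ x + evec a l.*2.+1 *~ y]].

Definition affine_lattice (k : nat) : set (int * int) :=
  if odd k then lattice_odd k./2 else lattice_even k./2.

(* The value lam 0 is irrelevant. *)
Definition point_construction (lam : nat -> int) (Z : nat -> int * int) : Prop :=
  Z 0 = (0, 0) /\
  forall k : nat, let l := k./2 in
  [/\ 0 < lam k.+1,
      Z k.+1 = Z k + evec a k *~ ((Pk l)%:Z * lam k.+1),
      affine_lattice k.+1 (Z k.+1)
    & `|(lam k.+1)%:Q - (a k.+1)%:Q / (2 * (Pk l)%:Q)| <= (Qk l.+1)%:Q / 2].

End Construction.

Definition is_cfrac_expansion (R : realType) (alpha : R) (a : nat -> int) : Prop :=
  (forall j : nat, (0 < j)%N -> 0 < a j) /\
  (ratr (cfrac a k) : R) @[k --> \oo] --> alpha.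

(* Main.v *)
Require Import Defs.
From HB Require Import structures.
From mathcomp Require Import all_boot all_order all_algebra.
From mathcomp Require Import all_classical all_reals all_analysis.
From mathcomp Require Import ring lra zify.
Set Implicit Arguments.
Unset Strict Implicit.
Unset Printing Implicit Defensive.
Import Order.TTheory GRing.Theory Num.Theory.
Import numFieldNormedType.Exports.
Local Open Scope classical_set_scope.
Local Open Scope ring_scope.

(* Fix k and put (q, r) - Z_k = x e_(k-1) + y e_k.  As Z_k lies in the k-th affine
   lattice, the prime attached to (x, y) (to (y, x) for odd k) would divide both q
   and r if (x, y) were in Omega_[k/2]; hence max(1, |x|) max(1, |y|) > [k/2].
   The choice of lambda makes b_k close to v_k / 2 and eta - (b_k alpha - c_k) close
   to -(v_(k-1) alpha - u_(k-1)) / 2, so that, for q between v_k / 8 and v_(k+1) / 8,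
   q |q alpha - eta - r| is comparable with |x + 1/2| |y + 1/2|, hence at least a
   constant times k.  Finally, a_k <= exp (gamma k (log k)^2) gives
   log q = O(k^2 (log k)^2). *)

(** * Continuants and the vectors [evec] *)

(** The pair (v_k, u_k), computed from the front like [cfrac]: a_0 plus the inverse of e.2 / e.1 is
    (a_0 e.2 + e.1) / e.2. *)
Fixpoint continuants (a : nat -> int) (k : nat) : int * int :=
  if k is k'.+1 then
    let e := continuants (fun j => a j.+1) k' in (e.2, a 0 * e.2 + e.1)
  else (1, a 0).

Lemma pair_mulrz (e : int * int) (n : int) : e *~ n = (e.1 * n, e.2 * n).
Proof. by rewrite -!mulrzz -(raddfMz fst) -(raddfMz snd); case: (e *~ n). Qed.

Lemma pair_addr (e f : int * int) : e + f = (e.1 + f.1, e.2 + f.2).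
Proof. by []. Qed.

(** The front recursion is linear in the pair of the shifted sequence, so the usual recurrence at
    the last index passes from the tail to the whole sequence. *)
Lemma continuants_rec (a : nat -> int) (k : nat) :
  continuants a k.+2 = continuants a k.+1 *~ a k.+2 + continuants a k.
Proof.
elim: k a => [|k IH] a.
  by rewrite pair_mulrz pair_addr /=; congr pair; ring.
have := IH (fun j => a j.+1); rewrite !pair_mulrz !pair_addr.
set e2 := continuants _ k.+2; set e1 := continuants _ k.+1.
set e0 := continuants _ k.
move=> E.
have -> : continuants a k.+3 = (e2.2, a 0 * e2.2 + e2.1) by [].
have -> : continuants a k.+2 = (e1.2, a 0 * e1.2 + e1.1) by [].
by rewrite E /=; congr pair; ring.
Qed.

Lemma continuants_gt0 (a : nat -> int) (k : nat) :
  (forall j, (0 < j)%N -> 0 < a j) ->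
  0 < (continuants a k).1 /\ (0 < a 0 -> 0 < (continuants a k).2).
Proof.
elim: k a => [|k IH] a apos //=.
have [|h1 /(_ (apos _ _)) h2] := IH (fun j => a j.+1); first by move=> j _; apply: apos.
split; first exact: h2.
by move=> a0; rewrite addr_gt0 ?mulr_gt0 ?h2.
Qed.

(** Prefixing a partial quotient acts by a matrix of determinant -1. *)
Lemma continuants_det (a : nat -> int) (k : nat) :
  (continuants a k).1 * (continuants a k.+1).2
    - (continuants a k.+1).1 * (continuants a k).2 = (-1) ^+ k.
Proof.
elim: k a => [|k IH] a; first by rewrite /= expr0; ring.
have := IH (fun j => a j.+1).
set e1 := continuants _ k.+1; set e0 := continuants _ k => E.
have -> : continuants a k.+2 = (e1.2, a 0 * e1.2 + e1.1) by [].
have -> : continuants a k.+1 = (e0.2, a 0 * e0.2 + e0.1) by [].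
by rewrite exprS -E /=; ring.
Qed.

Lemma cfracE (a : nat -> int) (k : nat) :
  (forall j, (0 < j)%N -> 0 < a j) ->
  cfrac a k = (continuants a k).2%:~R / (continuants a k).1%:~R.
Proof.
elim: k a => [|k IH] a apos /=; first by rewrite divr1.
have apos' j : (0 < j)%N -> 0 < a j.+1 by move=> _; apply: apos.
have [h1 /(_ (apos _ _)) h2] := continuants_gt0 k apos'.
rewrite IH // invf_div rmorphD rmorphM /= mulrDl mulfK //.
by rewrite intr_eq0 gt_eqF ?h2.
Qed.

(** The determinant identity is a Bezout relation, so the quotient of the continuants is already in
    lowest terms. *)
Lemma evecE (a : nat -> int) (k : nat) :
  (forall j, (0 < j)%N -> 0 < a j) -> evec a k = continuants a k.
Proof.
move=> apos; rewrite /evec /convergent_den /convergent_num cfracE //.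
have [dpos _] := continuants_gt0 k apos.
have cop : coprimez (continuants a k).2 (continuants a k).1.
  have := continuants_det a k; move: (continuants a k.+1) => f E.
  apply/coprimezP; exists (- (-1) ^+ k * f.1, (-1) ^+ k * f.2) => /=.
  transitivity ((-1) ^+ k * (-1) ^+ k : int); last by rewrite -expr2 sqrr_sign.
  by rewrite -[X in _ = _ * X]E; ring.
rewrite coprimeq_num // coprimeq_den // gt_eqF // gtr0_sg // gtr0_norm // mul1r.
by case: (continuants a k).
Qed.

Lemma evec_pred_rec (a : nat -> int) (k : nat) :
  (forall j, (0 < j)%N -> 0 < a j) ->
  evec_pred a k.+2 = evec_pred a k.+1 *~ a k.+1 + evec_pred a k.
Proof.
move=> apos; case: k => [|k] /=; rewrite !evecE //; last exact: continuants_rec.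
by rewrite pair_mulrz pair_addr /=; congr pair; ring.
Qed.

Lemma evec_pred1_rec (a : nat -> int) (k : nat) :
  (forall j, (0 < j)%N -> 0 < a j) ->
  (evec_pred a k.+2).1 = a k.+1 * (evec_pred a k.+1).1 + (evec_pred a k).1.
Proof. by move=> apos; rewrite evec_pred_rec // pair_mulrz pair_addr [X in _ = X + _]mulrC. Qed.

Lemma evec_pred2_rec (a : nat -> int) (k : nat) :
  (forall j, (0 < j)%N -> 0 < a j) ->
  (evec_pred a k.+2).2 = a k.+1 * (evec_pred a k.+1).2 + (evec_pred a k).2.
Proof. by move=> apos; rewrite evec_pred_rec // pair_mulrz pair_addr [X in _ = X + _]mulrC. Qed.

Lemma evec_pred_det (a : nat -> int) (k : nat) :
  (forall j, (0 < j)%N -> 0 < a j) ->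
  (evec_pred a k.+1).1 * (evec_pred a k).2
    - (evec_pred a k).1 * (evec_pred a k.+1).2 = (-1) ^+ k.
Proof.
move=> apos; case: k => [|k]; rewrite /evec_pred !evecE //.
  by rewrite /= expr0; ring.
by rewrite exprS -(continuants_det a k); ring.
Qed.

Lemma evec_pred1_gt0 (a : nat -> int) (k : nat) :
  (forall j, (0 < j)%N -> 0 < a j) -> 0 < (evec_pred a k.+1).1.
Proof. by move=> apos; rewrite /evec_pred evecE //; case: (continuants_gt0 k apos). Qed.

Lemma evec_pred1_mono (a : nat -> int) (k : nat) :
  (forall j, (0 < j)%N -> 0 < a j) -> (evec_pred a k).1 <= (evec_pred a k.+1).1.
Proof.
move=> apos; case: k => [|k]; first by rewrite ltW // evec_pred1_gt0.
rewrite evec_pred1_rec //.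
have := evec_pred1_gt0 k apos; have := apos k.+1 isT.
have : 0 <= (evec_pred a k).1.
  by case: k => // k; rewrite ltW // evec_pred1_gt0.
nia.
Qed.

Lemma evec_pred1_ge (a : nat -> int) (k : nat) :
  (forall j, (0 < j)%N -> 0 < a j) -> k.+1%:Z <= (evec_pred a k.+2).1.
Proof.
move=> apos; elim: k => [|k IH]; first exact: evec_pred1_gt0.
rewrite evec_pred1_rec //.
have := evec_pred1_gt0 k apos; have := apos k.+2 isT; nia.
Qed.

(* Convergents of index at least [k] all lie on one side of the [k]-th one. *)
Lemma evec_pred_side (a : nat -> int) (k m : nat) :
  (forall j, (0 < j)%N -> 0 < a j) ->
  0 <= (-1) ^+ k * ((evec_pred a (k + m)).1 * (evec_pred a k).2
                    - (evec_pred a k).1 * (evec_pred a (k + m)).2).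
Proof.
move=> apos; pose F m := (-1) ^+ k * ((evec_pred a (k + m)).1 * (evec_pred a k).2
  - (evec_pred a k).1 * (evec_pred a (k + m)).2).
(* F satisfies the second-order recurrence of the convergents, with positive coefficients, so two
   consecutive values are carried along. *)
rewrite -/(F m); suff [] : 0 <= F m /\ 0 <= F m.+1 by [].
elim: m => [|m [IH0 IH1]]; first split.
- have -> : F 0%N = 0 by rewrite /F addn0; ring.
  by [].
- by rewrite /F addn1 evec_pred_det // -expr2 sqrr_sign.
split=> //; have -> : F m.+2 = a (k + m).+1 * F m.+1 + F m.
  by rewrite /F !addnS evec_pred1_rec // evec_pred2_rec //; ring.
apply: addr_ge0 => //; apply: mulr_ge0 => //; exact/ltW/apos.
Qed.

(** * Distances of the convergents to alpha *)

(* The distance |v_(k-1) alpha - u_(k-1)|; the index is shifted by one, as in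
   [evec_pred]. *)
Definition conv_dist (R : realType) (alpha : R) (a : nat -> int) (k : nat) : R :=
  (-1) ^+ k * ((evec_pred a k).2%:~R - (evec_pred a k).1%:~R * alpha).

(** With a late convergent in place of alpha, [evec_pred_side] gives the sign; it survives in the
    limit. *)
Lemma conv_dist_ge0 (R : realType) (alpha : R) (a : nat -> int) (k : nat) :
  is_cfrac_expansion alpha a -> 0 <= conv_dist alpha a k.
Proof.
move=> [apos acvg]; rewrite /conv_dist.
pose f (x : R) := (-1) ^+ k * ((evec_pred a k).2%:~R - (evec_pred a k).1%:~R * x).
have fcvg : f (ratr (cfrac a m)) @[m --> \oo] --> f alpha.
  apply: cvgM; first exact: cvg_cst.
  apply: cvgB; first exact: cvg_cst.
  by apply: cvgM => //; exact: cvg_cst.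
rewrite -/(f alpha) -(cvg_lim _ fcvg) //.
apply: limr_ge; first by apply/cvg_ex; exists (f alpha).
exists k => // m /= lekm.
have vpos : 0 < (evec_pred a m.+1).1%:~R :> R by rewrite ltr0z evec_pred1_gt0.
rewrite /f cfracE // -evecE // -[evec a m]/(evec_pred a m.+1).
rewrite fmorph_div /= !ratr_int -[leRHS](mulfK (lt0r_neq0 vpos)).
apply: divr_ge0; last exact: ltW.
have -> (s x y z w : R) : 0 < w -> s * (x - y * (z / w)) * w = s * (w * x - y * z).
  by move=> w0; field; rewrite gt_eqF.
have := evec_pred_side k (m.+1 - k) apos; rewrite subnKC ?leqW //.
  by rewrite -(ler0z R) rmorphM rmorphB !rmorphM rmorphXn /= rmorphN rmorph1.
by [].
Qed.

Lemma conv_dist_rec (R : realType) (alpha : R) (a : nat -> int) (k : nat) :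
  (forall j, (0 < j)%N -> 0 < a j) ->
  conv_dist alpha a k
    = (a k.+1)%:~R * conv_dist alpha a k.+1 + conv_dist alpha a k.+2.
Proof.
move=> apos; rewrite /conv_dist evec_pred1_rec // evec_pred2_rec //.
by rewrite !rmorphD !rmorphM /= !exprS; ring.
Qed.

Lemma conv_dist_det (R : realType) (alpha : R) (a : nat -> int) (k : nat) :
  (forall j, (0 < j)%N -> 0 < a j) ->
  (evec_pred a k.+1).1%:~R * conv_dist alpha a k
    + (evec_pred a k).1%:~R * conv_dist alpha a k.+1 = 1.
Proof.
move=> apos; have := congr1 (fun z : int => z%:~R : R) (evec_pred_det k apos).
rewrite rmorphB !rmorphM rmorphXn /= rmorphN rmorph1 => E.
transitivity ((-1) ^+ k * (-1) ^+ k : R); last by rewrite -expr2 sqrr_sign.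
by rewrite -[X in _ = _ * X]E /conv_dist exprS; ring.
Qed.

(** By [conv_dist_det] the distance is at most the inverse of the next denominator, and denominators
    grow at least linearly. *)
Lemma cvg_conv_dist (R : realType) (alpha : R) (a : nat -> int) :
  is_cfrac_expansion alpha a -> conv_dist alpha a k @[k --> \oo] --> (0 : R).
Proof.
move=> hcf; have apos := hcf.1.
rewrite -(cvg_shiftS (conv_dist alpha a)) /=.
apply: (@squeeze_cvgr _ _ _ _ (fun=> 0) (@harmonic R)).
- near=> n; rewrite conv_dist_ge0 //=.
  have vge : (n.+1%:R : R) <= (evec_pred a n.+2).1%:~R.
    by rewrite -[n.+1%:R]/(n.+1%:Z%:~R) ler_int evec_pred1_ge.
  have n0 : 0 < n.+1%:R :> R by rewrite ltr0n.
  rewrite -div1r ler_pdivlMr // mulrC -[leRHS](conv_dist_det alpha n.+1 apos) -[leLHS]addr0.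
  apply: lerD; first by apply: ler_wpM2r => //; exact: conv_dist_ge0.
  apply: mulr_ge0; last exact: conv_dist_ge0.
  by rewrite ler0z; apply/ltW/evec_pred1_gt0.
- exact: cvg_cst.
- exact: cvg_harmonic.
Unshelve. all: by end_near.
Qed.

(** * The index sets and the products of primes *)

Lemma OmegaS (k : nat) (z : int * int) : z \in Omega k -> z \in Omega k.+1.
Proof.
rewrite !mem_Omega /in_Omega /=; case: eqP => [-> /eqP -> //|_ /leq_trans]; exact.
Qed.

Lemma Omega_bound (k : nat) (i j : int) :
  (i, j) \in Omega k -> - k%:Z <= i <= k%:Z /\ - k%:Z <= j <= k%:Z.
Proof.
rewrite mem_filter => /andP[_ /allpairsP[[i' j'] [/= + + [-> ->]]]].
by rewrite !mem_centered_range -!lez_nat !abszE !ler_norml => -> ->.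
Qed.

Lemma prime_indexing_prime (p : int * int -> nat) (k : nat) (z : int * int) :
  prime_indexing p -> z \in Omega k -> prime (p z).
Proof.
move=> [p00 pbij]; elim: k => [|k IH].
  by rewrite mem_Omega => /eqP ->; rewrite p00.
case: (boolP (z \in Omega k)) => [/IH //|zk zk1].
have [/(_ z (conj zk1 zk)) [s /= /andP[sgt _] <-] _ _] := pbij k.
case: s sgt => // s _ /=.
by case: ex_minnP => m /andP[].
Qed.

Lemma dvdn_Pk (p : int * int -> nat) (k : nat) (z : int * int) :
  z \in Omega k -> (p z %| Pk p k)%N.
Proof. by move=> zk; rewrite /Pk (big_rem z zk) dvdn_mulr. Qed.

Lemma dvdn_Ak (p : int * int -> nat) (k : nat) (z : int * int) :
  z \in Omega k -> (p z %| Ak p k z.1)%N.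
Proof. by move=> zk; rewrite /Ak (big_rem z zk) eqxx dvdn_mulr. Qed.

Lemma dvdn_Bk (p : int * int -> nat) (k : nat) (z : int * int) :
  z \in Omega k -> (p z %| Bk p k z.2)%N.
Proof. by move=> zk; rewrite /Bk (big_rem z zk) eqxx dvdn_mulr. Qed.

(** The set [Omega k] contains the 2k + 1 points (i, 0) with |i| <= k, and each contributes a prime,
    so P_k >= 2^(2k+1). *)
Lemma Pk_gt (p : int * int -> nat) (k : nat) :
  prime_indexing p -> (k.*2.+1 < Pk p k)%N.
Proof.
move=> hp; apply: (@leq_trans (2 ^ size (Omega k))).
  apply: (@leq_trans (2 ^ k.*2.+1)); first exact: ltn_expl.
  rewrite leq_exp2l //.
  have <- : size [seq (i, 0 : int) | i <- centered_range k] = k.*2.+1.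
    by rewrite !size_map size_iota.
  apply: uniq_leq_size.
    rewrite map_inj_uniq; last by move=> i j [].
    by rewrite map_inj_uniq ?iota_uniq // => m n /addIr[].
  move=> z /mapP[i]; rewrite mem_centered_range => ik ->.
  rewrite mem_Omega /in_Omega; case: eqP ik => [-> |/eqP k0 ik].
    by rewrite leqn0 absz_eq0 => /eqP ->.
  by rewrite /= [maxn 1 0]/= muln1 geq_max lt0n k0.
rewrite /Pk; have : {in Omega k, forall z, (1 < p z)%N}.
  by move=> z /(prime_indexing_prime hp)/prime_gt1.
elim: (Omega k) => [|z s IH] hs; first by rewrite big_nil.
rewrite big_cons expnS leq_mul //; first by rewrite hs // mem_head.
by apply: IH => y ys; rewrite hs // in_cons ys orbT.
Qed.

(** * Coordinates relative to Z_k and coprimality *)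

(** Two consecutive vectors have determinant 1 or -1, hence form a basis of the integer plane; the
    coordinates come from Cramer's rule. *)
Lemma lattice_coords (a : nat -> int) (k : nat) (w z : int * int) :
  (forall j, (0 < j)%N -> 0 < a j) ->
  exists x y : int, w = z + evec_pred a k *~ x + evec_pred a k.+1 *~ y.
Proof.
move=> apos; have := evec_pred_det k apos.
move: (evec_pred a k) (evec_pred a k.+1) => [e1 e2] [f1 f2] /= E.
case: w z => [q r] [b c].
exists ((-1) ^+ k * (f1 * (r - c) - f2 * (q - b))).
exists ((-1) ^+ k * ((q - b) * e2 - (r - c) * e1)).
have Es : (-1) ^+ k * (f1 * e2 - e1 * f2) = 1 :> int by rewrite E -expr2 sqrr_sign.
rewrite !pair_mulrz !pair_addr /=; congr pair.
- transitivity (b + (q - b) * ((-1) ^+ k * (f1 * e2 - e1 * f2))); last ring.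
  by rewrite Es; ring.
- transitivity (c + (r - c) * ((-1) ^+ k * (f1 * e2 - e1 * f2))); last ring.
  by rewrite Es; ring.
Qed.

Lemma coprime_coords (p : int * int -> nat) (a X Y lam : nat -> int)
    (Z : nat -> int * int) (k : nat) (q r x y : int) :
  prime_indexing p -> crt_solutions p X Y -> point_construction p a X Y lam Z ->
  coprimez q r -> (0 < k)%N ->
  (q, r) = Z k + evec_pred a k *~ x + evec_pred a k.+1 *~ y ->
  (k./2 < maxn 1 `|x| * maxn 1 `|y|)%N.
Proof.
move=> hp hcrt [_ hZ] cop k0 wE; rewrite ltnNge; apply/negP => xyl.
have l0 : (k./2 != 0)%N.
  by rewrite -lt0n; apply: leq_trans xyl; rewrite muln_gt0 !leq_max.
(* Here x', y' are the coordinates of Z_k itself: a prime dividing both x' + x and y' + y would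
   divide q and r. *)
have nodvd (n : nat) (x' y' : int) : prime n ->
    Z k = evec_pred a k *~ x' + evec_pred a k.+1 *~ y' ->
    (n%:Z %| x' + x)%Z -> (n%:Z %| y' + y)%Z -> False.
  move=> npr ZE nx ny; move: wE; rewrite ZE.
  move: (evec_pred a k) (evec_pred a k.+1) => [e1 e2] [f1 f2].
  rewrite !pair_mulrz !pair_addr /= => -[qE rE].
  have hdiv (u v : int) : (n%:Z %| u * (x' + x) + v * (y' + y))%Z.
    by rewrite rpredD // dvdz_mull.
  have qE' : q = e1 * (x' + x) + f1 * (y' + y) by rewrite qE; ring.
  have rE' : r = e2 * (x' + x) + f2 * (y' + y) by rewrite rE; ring.
  have : (n%:Z %| gcdz q r)%Z by rewrite dvdz_gcd qE' rE' !hdiv.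
  by rewrite (eqP cop) dvdz1 /= => /eqP n1; rewrite n1 in npr.
have dvd_shift (n : nat) (m : nat) (u v w : int) : (n %| m)%N ->
    (u = v %[mod m])%Z -> (n%:Z %| v + w)%Z -> (n%:Z %| u + w)%Z.
  move=> nm /eqP; rewrite eqz_mod_dvd => muv nvw.
  have -> : u + w = (u - v) + (v + w) by ring.
  by rewrite rpredD // (dvdz_trans _ muv) //.
(* The construction records lattice membership for successor indices only, hence the call at k - 1
   with k > 0. *)
have [_ _ + _] := hZ k.-1; rewrite prednK // /affine_lattice.
case: ifP => kodd.
  case=> x' [y' [hx hy ZE]].
  (* In the odd lattice X and Y trade places, so the prime is that of (y, x); the congruence for x'
     has modulus P_(l+1), which calls for [OmegaS]. *)
  have yx : (y, x) \in Omega k./2 by rewrite mem_Omega /in_Omega (negbTE l0) mulnC.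
  have pr := prime_indexing_prime hp yx.
  have [/(Omega_bound)[yb _] /Omega_bound[_ xb]] := (yx, OmegaS yx).
  have [_ _ hX _] := hcrt k./2; have [_ _ _ hY] := hcrt k./2.+1.
  have kE : k = k./2.*2.+1 by rewrite -[LHS]odd_double_half kodd.
  have e0 : evec_pred a k = evec a k./2.*2 by rewrite {1}kE.
  have e1 : evec_pred a k.+1 = evec a k./2.*2.+1 by rewrite {1}kE.
  apply: (nodvd (p (y, x)) x' y' pr); first by rewrite ZE e0 e1.
  - apply: dvd_shift hx _; first exact/dvdn_Pk/OmegaS.
    by apply: dvdz_trans (hY _ xb); exact: (@dvdn_Bk p _ (y, x) (OmegaS yx)).
  - apply: dvd_shift hy _; first exact/dvdn_Pk.
    by apply: dvdz_trans (hX _ yb); exact: (@dvdn_Ak p _ (y, x) yx).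
case=> x' [y' [hx hy ZE]].
have xy : (x, y) \in Omega k./2 by rewrite mem_Omega /in_Omega (negbTE l0).
have pr := prime_indexing_prime hp xy.
have [xb yb] := Omega_bound xy.
have [_ _ hX hY] := hcrt k./2.
have kE : k = k./2.*2 by rewrite -[LHS]odd_double_half kodd.
have e0 : evec_pred a k = evec_pred a k./2.*2 by rewrite {1}kE.
have e1 : evec_pred a k.+1 = evec a k./2.*2 by rewrite {1}kE.
apply: (nodvd (p (x, y)) x' y' pr); first by rewrite ZE e0 e1.
- apply: dvd_shift hx _; first exact/dvdn_Pk.
  by apply: dvdz_trans (hX _ xb); exact: (@dvdn_Ak p _ (x, y) xy).
- apply: dvd_shift hy _; first exact/dvdn_Pk.
  by apply: dvdz_trans (hY _ yb); exact: (@dvdn_Bk p _ (x, y) xy).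
Qed.

(** * Size of one step of the construction *)

(** Multiplying the condition on lambda by 2 P_l gives |2t - a_(k+1)| <= P_l Q_(l+1) <= P_(l+1): the
    step t is half of a_(k+1) up to a relative error 1 / W_k. *)
Lemma step_bounds (p : int * int -> nat) (a X Y lam : nat -> int)
    (Z : nat -> int * int) (W : nat -> nat) (k : nat) :
  prime_indexing p -> point_construction p a X Y lam Z ->
  (W k)%:Z * (Pk p k./2.+1)%:Z <= a k.+1 ->
  let t := (Pk p k./2)%:Z * lam k.+1 in
  [/\ 0 < t, Z k.+1 = Z k + evec_pred a k.+1 *~ t
    & (W k)%:Z * `|2 * t - a k.+1| <= a k.+1].
Proof.
move=> hp [_ hZ] ha t; have [lam0 ZE _ hlam] := hZ k.
have P0 : (0 < Pk p k./2)%N by apply: leq_trans (Pk_gt k./2 hp).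
split=> //; first by rewrite mulr_gt0.
apply: le_trans ha; apply: ler_wpM2l => //.
have : (`|2 * t - a k.+1|)%:~R <= (Pk p k./2 * Qk p k./2.+1)%:R :> rat.
  have P0' : 0 < (Pk p k./2)%:R :> rat by rewrite ltr0n.
  have := ler_wpM2l (ltW (mulr_gt0 (ltr0n _ 2) P0')) hlam.
  rewrite -[X in X * `|_|]gtr0_norm ?mulr_gt0 // -normrM.
  set u := (X in `|X| <= _); set v := (X in _ <= X).
  have -> : u = (2 * t - a k.+1)%:~R.
    rewrite /u /t rmorphB !rmorphM /= mulrBr; field.
    exact: lt0r_neq0.
  have -> : v = (Pk p k./2 * Qk p k./2.+1)%:R.
    by rewrite /v natrM; field.
  by rewrite -intr_norm.
rewrite -[(_ * _)%:R]/((Posz _)%:~R) ler_int => /le_trans; apply.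
by rewrite lez_nat mulnC leq_trunc_div.
Qed.

(** * The inequality between the coordinates and the form *)

(* [v, v'] are two consecutive denominators, [d, d'] the corresponding distances
   and [A, A'] the partial quotients linking them to their neighbours. *)
Lemma coords_le_form (R : realFieldType) (x y : int)
    (q L v v' d d' b T A A' K : R) :
  0 < v -> 0 <= v' -> 0 <= d -> 0 <= d' -> v * d + v' * d' = 1 ->
  A * v' <= v -> A' * d' <= d -> 20 * (K + 2) <= A -> 60 <= A' ->
  `|b - v / 2| <= v / 20 -> `|T + d / 2| <= d / 20 ->
  q = b + x%:~R * v' + y%:~R * v -> L = x%:~R * d - y%:~R * d' - T ->
  0 < q -> q * d' <= 1 / 8 -> v * `|L| <= K ->
  ((maxn 1 `|x| * maxn 1 `|y|)%N)%:R <= 200 * (q * `|L|).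
Proof.
move=> v0 v'0 d0 d'0 vd Av Ad hA hA' hb hT hq hL q0 qd' vL.
have K0 : 0 <= K by apply: le_trans vL; rewrite mulr_ge0 // ltW.
have v'v : 20 * (K + 2) * v' <= v by apply: le_trans Av; rewrite ler_wpM2r.
have d'd : 60 * d' <= d by apply: le_trans Ad; rewrite ler_wpM2r.
have Kv : 0 <= K * v' by rewrite mulr_ge0.
have vd'0 : 0 <= v' * d' by rewrite mulr_ge0.
have vd0 : 0 <= v * d by rewrite mulr_ge0 // ltW.
have vd'' : v' * d' <= v * d.
  by apply: ler_pM => //; nra.
move: hb hT; rewrite !ler_norml => /andP[b1 b2] /andP[T1 T2].
have vd'd : 60 * (v * d') <= v * d by nra.
(* Eliminating y between the formulas for q and L, by v d + v' d' = 1, gives an a priori bound on x;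
   it makes x v' negligible against v, and then y d' is controlled through q d' <= 1/8. *)
have xE : x%:~R = v * L + d' * q + v * T - d' * b.
  transitivity (x%:~R * (v * d + v' * d')); first by rewrite vd mulr1.
  by rewrite hL hq; ring.
have xK : `|x%:~R : R| <= K + 1.
  have : `|v * L| <= K by rewrite normrM (gtr0_norm v0).
  rewrite xE !ler_norml => /andP[L1 L2].
  have : 0 <= d' * q by rewrite mulr_ge0 // ltW.
  have : - (11 / 20) * (v * d) <= v * T <= - (9 / 20) * (v * d) by apply/andP; split; nra.
  move=> /andP[? ?].
  have : 9 / 20 * (v * d') <= d' * b <= 11 / 20 * (v * d') by apply/andP; split; nra.
  move=> /andP[? ?].
  have : 0 <= v * d' by nra.
  by move=> ? ?; apply/andP; split; lra.
have xv : `|x%:~R * v'| <= v / 20.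
  rewrite normrM (ger0_norm v'0); apply: (@le_trans _ _ ((K + 1) * v')).
    by rewrite ler_wpM2r.
  by nra.
have yv : `|y%:~R : R| * v <= q + 11 / 20 * v + v / 20.
  rewrite -[in X in _ * X](gtr0_norm v0) -normrM.
  have -> : y%:~R * v = q - b - x%:~R * v' by rewrite hq; ring.
  by move: xv; rewrite !ler_norml => /andP[? ?]; apply/andP; split; lra.
have yd : `|y%:~R * d'| <= 27 / 100 * d.
  rewrite normrM (ger0_norm d'0) -(ler_pM2l v0).
  have : `|y%:~R| * v * d' <= (q + 11 / 20 * v + v / 20) * d' by rewrite ler_wpM2r.
  by lra.
(* An integer stays at distance at least 1/2 from -1/2. The 2/5 absorbs the errors below: 27/100 +
   1/20 for L, and 1/20 + 1/20 for q. *)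
have intmax (z : int) : ((maxn 1 `|z|)%N)%:R / 10 <= `|z%:~R + 1 / 2| - 2 / 5 :> R.
  case: z => [[|n]|n].
  - by rewrite -[maxn 1 _]/1%N mulr0z add0r ger0_norm; lra.
  - rewrite (maxn_idPr _) // -[(Posz n.+1)%:~R]/(n.+1%:R) absz_nat -natr1.
    by have n0 : 0 <= n%:R :> R by []; rewrite ger0_norm; lra.
  - rewrite (maxn_idPr _) // NegzE abszN mulrNz -[(Posz n.+1)%:~R]/(n.+1%:R) absz_nat -natr1.
    by have n0 : 0 <= n%:R :> R by []; rewrite ler0_norm; lra.
have HL : d * (((maxn 1 `|x|)%N)%:R / 10) <= `|L|.
  apply: (@le_trans _ _ (d * (`|x%:~R + 1 / 2| - 2 / 5))).
    by apply: ler_wpM2l.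
  have e1 : d * `|x%:~R + 1 / 2| = `|L + y%:~R * d' + (T + d / 2)|.
    by rewrite -[in LHS](ger0_norm d0) -normrM hL; congr `|_|; field.
  have := ler_normD (L + y%:~R * d') (T + d / 2).
  have := ler_normD L (y%:~R * d').
  have : `|T + d / 2| <= d / 20 by rewrite ler_norml T1 T2.
  by rewrite mulrBr e1; lra.
have Hq : v * (((maxn 1 `|y|)%N)%:R / 10) <= q.
  apply: (@le_trans _ _ (v * (`|y%:~R + 1 / 2| - 2 / 5))).
    by rewrite ler_pM2l.
  have e1 : v * `|y%:~R + 1 / 2| = `|q - (b - v / 2) - x%:~R * v'|.
    by rewrite -[in LHS](gtr0_norm v0) -normrM hq; congr `|_|; field.
  have := ler_normB (q - (b - v / 2)) (x%:~R * v').
  have := ler_normB q (b - v / 2).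
  have : `|b - v / 2| <= v / 20 by rewrite ler_norml b1 b2.
  by rewrite mulrBr e1 (gtr0_norm q0); lra.
have n0 (n : nat) : 0 <= n%:R / 10 :> R by rewrite divr_ge0.
have := ler_pM (mulr_ge0 (ltW v0) (n0 _)) (mulr_ge0 d0 (n0 _)) Hq HL.
set mx := (maxn 1 `|x|)%N; set my := (maxn 1 `|y|)%N.
have -> : v * (my%:R / 10) * (d * (mx%:R / 10)) = v * d * (mx * my)%N%:R / 100.
  by rewrite natrM; field.
have : 0 <= (mx * my)%N%:R :> R by [].
move: ((mx * my)%N%:R : R) => m m0 h.
(* As v' d' <= v d and the two add up to 1; with the two factors 1/10 this makes the constant
   200. *)
have : 1 / 2 <= v * d by lra.
by nra.
Qed.

(** * Convergence to eta and bounds on b_k *)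

Lemma telescoping_dist (R : realType) (s d : nat -> R) (k m : nat) :
  (forall n, `|s n.+1 - s n| <= d n - d n.+2) ->
  `|s (k + m)%N - s k| <= d k + d k.+1 - d (k + m)%N - d (k + m).+1.
Proof.
move=> hs; elim: m => [|m IH]; first by rewrite addn0 subrr normr0; lra.
rewrite addnS; have := hs (k + m)%N.
have := ler_normD (s (k + m).+1 - s (k + m)%N) (s (k + m)%N - s k).
by rewrite addrA subrK; lra.
Qed.

Lemma telescoping_cvg (R : realType) (s d : nat -> R) :
  (forall n, 0 <= d n) -> d @ \oo --> (0 : R) ->
  (forall n, `|s n.+1 - s n| <= d n - d n.+2) ->
  cvgn s /\ forall k, `|limn s - s k| <= d k + d k.+1.
Proof.
move=> d0 dcvg hs.
have dist k n : (k <= n)%N -> `|s n - s k| <= d k + d k.+1.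
  move=> kn; have := telescoping_dist k (n - k)%N hs; rewrite subnKC //.
  by have := d0 n; have := d0 n.+1; lra.
(* Subtracting d n + d (n+1), whose increments dominate those of s, leaves a bounded nondecreasing
   sequence. *)
have scvg : cvgn s.
  pose S n := s n - (d n + d n.+1).
  have Scvg : cvgn S.
    apply: nondecreasing_is_cvgn.
      apply/nondecreasing_seqP => n; rewrite /S.
      by have := hs n; rewrite ler_norml => /andP[? ?]; lra.
    exists (s 0%N + (d 0%N + d 1%N)) => _ [n _ <-]; rewrite /S.
    have := dist 0%N n isT; rewrite ler_norml => /andP[_].
    by have := d0 n; have := d0 n.+1; lra.
  have dcvgS : d n.+1 @[n --> \oo] --> (0 : R) by rewrite (cvg_shiftS d).
  have -> : s = S + (d + (fun n => d n.+1)).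
    by apply/funext => n; rewrite /S !fctE subrK.
  apply: is_cvgD => //; apply: is_cvgD; apply/cvg_ex; by exists 0.
split=> // k; rewrite ler_distl; apply/andP; split.
- apply: limr_ge => //; exists k => // n /= /dist.
  by rewrite ler_distl => /andP[].
- apply: limr_le => //; exists k => // n /= /dist.
  by rewrite ler_distl => /andP[].
Qed.

Lemma step_bound_real (R : realType) (a t : int) (W : nat) :
  (0 < W)%N -> W%:Z * `|2 * t - a| <= a ->
  `|2 * t%:~R - a%:~R| <= a%:~R / W%:R :> R.
Proof.
move=> W0; rewrite -(ler_int R) rmorphM /= intr_norm => h.
by rewrite ler_pdivlMr ?ltr0n // mulrC; move: h; rewrite rmorphB rmorphM.
Qed.

Lemma partial_form_step (R : realType) (alpha : R) (a : nat -> int)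
    (Z : nat -> int * int) (k : nat) (t : int) :
  Z k.+1 = Z k + evec_pred a k.+1 *~ t ->
  (Z k.+1).1%:~R * alpha - (Z k.+1).2%:~R =
  (Z k).1%:~R * alpha - (Z k).2%:~R + (-1) ^+ k * t%:~R * conv_dist alpha a k.+1.
Proof.
move=> ->; rewrite pair_mulrz pair_addr /conv_dist.
move: (Z k) (evec_pred a k.+1) => [b c] [e f] /=.
rewrite !rmorphD !rmorphM /= exprS.
have ss : (-1) ^+ k * (-1) ^+ k = 1 :> R by rewrite -expr2 sqrr_sign.
transitivity (b%:~R * alpha - c%:~R
  + (-1) ^+ k * (-1) ^+ k * (t%:~R * (e%:~R * alpha - f%:~R)) : R); last by ring.
by rewrite ss; ring.
Qed.

(** Since W >= 1 forces t <= a_(n+1), each increment is at most a_(n+1) times the distance of index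
    n + 1, which [conv_dist_rec] turns into a telescoping difference. *)
Lemma partial_form_cvg (R : realType) (p : int * int -> nat) (X Y : nat -> int)
    (alpha : R) (a : nat -> int) (W : nat -> nat)
    (lam : nat -> int) (Z : nat -> int * int) :
  prime_indexing p -> is_cfrac_expansion alpha a -> (forall k, (0 < W k)%N) ->
  (forall k : nat, (W k)%:Z * (Pk p k./2.+1)%:Z <= a k.+1) ->
  point_construction p a X Y lam Z ->
  let u : nat -> R := fun k => (Z k).1%:~R * alpha - (Z k).2%:~R in
  cvgn u /\
  forall k, `|limn u - u k| <= conv_dist alpha a k + conv_dist alpha a k.+1.
Proof.
move=> hp hcf W0 ha hZ u; apply: telescoping_cvg.
- by move=> n; exact: conv_dist_ge0.
- exact: cvg_conv_dist.
move=> n; have [t0 ZE tb] := step_bounds hp hZ (ha n).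
rewrite /u (partial_form_step _ ZE) addrAC subrr add0r.
have d0 := conv_dist_ge0 n.+1 hcf; rewrite (conv_dist_rec alpha n hcf.1) addrK.
rewrite normrM (ger0_norm d0) normrM normr_sign mul1r; apply: ler_wpM2r => //.
rewrite ger0_norm ?ler_int; last by rewrite ler0z; exact: ltW.
have := W0 n; move: (hcf.1 n.+1 isT) tb t0; move: (_ * lam n.+1) (W n) => t w.
nia.
Qed.

(** Again t <= a_(k+1), so b grows by at most a_(k+1) v_k = v_(k+1) - v_(k-1) in one step. *)
Lemma partial_den_bounds (p : int * int -> nat) (X Y : nat -> int)
    (a : nat -> int) (W : nat -> nat)
    (lam : nat -> int) (Z : nat -> int * int) (k : nat) :
  prime_indexing p -> (forall j, (0 < j)%N -> 0 < a j) -> (forall k, (0 < W k)%N) ->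
  (forall k : nat, (W k)%:Z * (Pk p k./2.+1)%:Z <= a k.+1) ->
  point_construction p a X Y lam Z ->
  0 <= (Z k).1 <= (evec_pred a k.+1).1 + (evec_pred a k).1.
Proof.
move=> hp apos W0 ha hZ; elim: k => [|k IH].
  by rewrite hZ.1 /= addr_ge0 // ltW // denq_gt0.
have [t0 -> tb] := step_bounds hp hZ (ha k).
rewrite pair_mulrz pair_addr (evec_pred1_rec _ apos) [(_, _).1]/=.
have := W0 k; move: (apos k.+1 isT) tb t0 IH (evec_pred1_gt0 k apos).
move: (_ * lam k.+1) (W k) => t w a0 tb t0 IH v0 w0.
have ta : t <= a k.+1 by nia.
have : 0 <= (evec_pred a k.+1).1 * t <= (evec_pred a k.+1).1 * a k.+1.
  by apply/andP; split; [rewrite mulr_ge0 // ltW|rewrite ler_pM2l].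
case/andP: IH => ? ? /andP[? ?]; apply/andP; split; lra.
Qed.

(** * The lower bound at a fixed index *)

Lemma half_lt_leq_double (n m : nat) : (n./2 < m)%N -> (n <= 2 * m)%N.
Proof. by rewrite -[n in (n <= _)%N]odd_double_half; case: (odd n); lia. Qed.

(** Combines [coprime_coords] with [coords_le_form] for the vectors e_k and e_(k+1). The bound on
    v_(k+1) |L| costs nothing later: when it fails, |L| is already large. *)
Lemma form_ge_index (R : realType) (p : int * int -> nat) (X Y : nat -> int)
    (alpha : R) (a : nat -> int) (W : nat -> nat)
    (lam : nat -> int) (Z : nat -> int * int) (k : nat) (q r : int) :
  prime_indexing p -> crt_solutions p X Y ->
  is_cfrac_expansion alpha a -> (forall k, (0 < W k)%N) ->
  (forall k : nat, (W k)%:Z * (Pk p k./2.+1)%:Z <= a k.+1) ->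
  point_construction p a X Y lam Z ->
  let eta := limn (fun k => (Z k).1%:~R * alpha - (Z k).2%:~R : R) in
  let L := q%:~R * alpha - eta - r%:~R in
  coprimez q r -> 0 < q -> (60 <= W k)%N -> (60 <= W k.+1)%N ->
  8 * q%:~R <= (evec_pred a k.+3).1%:~R :> R ->
  (evec_pred a k.+2).1%:~R * `|L| <= k.+1%:R ->
  k.+1%:R / 400 <= q%:~R * `|L|.
Proof.
move=> hp hcrt hcf W0 ha hZ eta L cop q0 Wk Wk1 qv vL.
have apos := hcf.1.
have [x [y wE]] := lattice_coords k.+1 (q, r) (Z k.+1) apos.
have xy := coprime_coords hp hcrt hZ cop (ltn0Sn k) wE.
have [_ tail] := partial_form_cvg hp hcf W0 ha hZ; rewrite -/eta in tail.
have d0 n := conv_dist_ge0 n hcf.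
have dR n := conv_dist_rec alpha n apos.
have vR n : (evec_pred a n.+2).1%:~R = (a n.+1)%:~R * (evec_pred a n.+1).1%:~R
    + (evec_pred a n).1%:~R :> R.
  by rewrite evec_pred1_rec // rmorphD rmorphM.
have v0 n : 0 < (evec_pred a n.+1).1%:~R :> R by rewrite ltr0z evec_pred1_gt0.
have v0' n : 0 <= (evec_pred a n).1%:~R :> R by case: n => // n; exact: ltW.
(* [Pk_gt] gives P_([n/2]+1) >= n + 3; the linear growth is what the hypothesis 20 (K + 2) <= A asks
   for with K = k + 1. *)
have a60 n : (60 <= W n)%N -> 60 * (n%:R + 3) <= (a n.+1)%:~R :> R.
  move=> Wn; have : (60 * (n + 3))%:Z <= a n.+1.
    apply: le_trans (ha n); rewrite -PoszM lez_nat; apply: leq_mul => //.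
    have := Pk_gt n./2.+1 hp; rewrite -[X in (X + _ <= _)%N](odd_double_half n).
    by case: (odd n); lia.
  by rewrite -(ler_int R) -[(Posz _)%:~R]/(_%:R) natrM natrD.
have Ak := a60 k Wk; have Ak1 := a60 k.+1 Wk1.
have tb n : (60 <= W n)%N -> exists t : int,
    Z n.+1 = Z n + evec_pred a n.+1 *~ t /\
    `|2 * t%:~R - (a n.+1)%:~R| <= (a n.+1)%:~R / 60 :> R.
  move=> Wn; have [_ ZE tb] := step_bounds hp hZ (ha n).
  exists ((Pk p n./2)%:Z * lam n.+1); split=> //.
  apply: (le_trans (step_bound_real R (W0 n) tb)).
  apply: ler_wpM2l; first by rewrite ler0z; exact/ltW/apos.
  by rewrite lef_pV2 ?ler_nat // posrE ltr0n.
have [t [ZE tk]] := tb k Wk; have [t1 [ZE1 tk1]] := tb k.+1 Wk1.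
(* The sign for which s (v_k alpha - u_k) is the distance d, while the next form, multiplied by s,
   is -d'. *)
pose s : R := - (-1) ^+ k.+1.
have ss : s * s = 1 by rewrite /s mulrNN -expr2 sqrr_sign.
have ns : `|s| = 1 by rewrite /s normrN normr_sign.
pose uu n : R := (Z n).1%:~R * alpha - (Z n).2%:~R.
have := @coords_le_form R x y q%:~R (s * L) (evec_pred a k.+2).1%:~R
  (evec_pred a k.+1).1%:~R (conv_dist alpha a k.+1) (conv_dist alpha a k.+2)
  (Z k.+1).1%:~R (s * (eta - uu k.+1)) (a k.+1)%:~R (a k.+2)%:~R k.+1%:R.
rewrite (_ : `|s * L| = `|L|); last by rewrite normrM ns mul1r.
move=> main.
suff : ((maxn 1 `|x| * maxn 1 `|y|)%N)%:R <= 200 * (q%:~R * `|L|) :> R.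
  have : (k.+1%:R : R) <= 2 * (maxn 1 `|x| * maxn 1 `|y|)%N%:R.
    by rewrite -natrM ler_nat; exact: half_lt_leq_double.
  by lra.
apply: main => //.
- exact: conv_dist_det.
- by rewrite vR lerDl.
- by rewrite (dR k.+1) lerDl.
- by rewrite -natr1; have : 0 <= k%:R :> R by []; lra.
- by have : 0 <= k.+1%:R :> R by []; lra.
(* b_(k+1) = b_k + t v_k with b_k <= 2 v_k and t close to a_(k+1) / 2, whereas v_(k+1) is a_(k+1)
   v_k + v_(k-1). *)
- have /andP[b1 b2] : 0 <= ((Z k).1%:~R : R) <= (evec_pred a k.+1).1%:~R
      + (evec_pred a k).1%:~R.
    by rewrite -rmorphD ler0z ler_int (partial_den_bounds k hp apos W0 ha hZ).
  have vm : (evec_pred a k).1%:~R <= (evec_pred a k.+1).1%:~R :> R.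
    by rewrite ler_int evec_pred1_mono.
  have : `|(evec_pred a k.+1).1%:~R * (2 * t%:~R - (a k.+1)%:~R)|
      <= (evec_pred a k.+1).1%:~R * ((a k.+1)%:~R / 60) :> R.
    by rewrite normrM ger0_norm // ler_wpM2l.
  have := ler_wpM2r (v0' k.+1) Ak; have := mulr_ge0 (ler0n R k) (v0' k.+1).
  rewrite vR ZE pair_mulrz pair_addr [(_, _).1]/= rmorphD rmorphM /=.
  have := v0' k.
  move: b1 b2 vm (v0' k.+1).
  rewrite !ler_norml => ? ? ? ? ? ? ? /andP[? ?].
  by apply/andP; split; lra.
(* The first term of the tail of eta, with t1 close to a_(k+2) / 2, carries about half of d; the
   rest is at most 2 d'. *)
- have := ler_wpM2r (d0 k.+2) Ak1; have := mulr_ge0 (ler0n R k.+1) (d0 k.+2).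
  have : `|s * (eta - uu k.+2)| <= conv_dist alpha a k.+2 + conv_dist alpha a k.+3.
    by rewrite normrM ns mul1r; exact: tail.
  have dm : conv_dist alpha a k.+3 <= conv_dist alpha a k.+2.
    rewrite (dR k.+2); have := d0 k.+4; have := d0 k.+3.
    have : 1 <= (a k.+3)%:~R :> R by rewrite -[1]/(1%:~R) ler_int; exact: apos.
    by nra.
  have uE : s * (eta - uu k.+1) = s * (eta - uu k.+2)
      - t1%:~R * conv_dist alpha a k.+2.
    rewrite [uu k.+2](partial_form_step alpha ZE1) -/(uu k.+1).
    have -> : (-1) ^+ k.+1 = - s by rewrite /s opprK.
    transitivity (s * (eta - uu k.+1) + (s * s - 1) * t1%:~R * conv_dist alpha a k.+2).
      by rewrite ss; ring.
    by ring.
  have : `|conv_dist alpha a k.+2 * (2 * t1%:~R - (a k.+2)%:~R)|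
      <= conv_dist alpha a k.+2 * ((a k.+2)%:~R / 60).
    by rewrite normrM ger0_norm // ler_wpM2l.
  rewrite uE (dR k.+1).
  move: dm (d0 k.+2) (d0 k.+3); move: (s * (eta - uu k.+2)) => w.
  rewrite !ler_norml => ? ? ? /andP[? ?] /andP[? ?] ? ?.
  by apply/andP; split; lra.
- move: wE; rewrite !pair_mulrz !pair_addr => /(congr1 fst) /= ->.
  by rewrite !rmorphD !rmorphM /=; ring.
- move: wE; rewrite !pair_mulrz !pair_addr /L /uu /conv_dist.
  have -> : (-1) ^+ k.+2 = s by rewrite exprS mulN1r.
  have -> : (-1) ^+ k.+1 = - s by rewrite /s opprK.
  move: (Z k.+1) (evec_pred a k.+1) (evec_pred a k.+2) => [b c] [e f] [e' f'].
  by move=> [-> ->]; rewrite /= !rmorphD !rmorphM /=; ring.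
- by rewrite ltr0z.
- have := conv_dist_det alpha k.+2 apos.
  have := mulr_ge0 (v0' k.+2) (d0 k.+3).
  have := ler_wpM2r (d0 k.+2) qv.
  by lra.
Qed.

(** * Growth of the denominators and logarithms *)

(** Each denominator is at most 2 a_j times the previous one, and every a_j with 2 <= j <= n obeys
    the bound taken at n. *)
Lemma evec_pred1_growth (R : realType) (a : nat -> int) (gamma : R) (n k : nat) :
  (forall j, (0 < j)%N -> 0 < a j) -> 0 < gamma ->
  (forall k : nat, (2 <= k)%N ->
     (a k)%:~R <= expR (gamma * k%:R * (ln (k%:R : R)) ^+ 2)) ->
  (k < n)%N ->
  (evec_pred a k.+2).1%:~R
    <= (a 1)%:~R * (2 * expR (gamma * n%:R * (ln (n%:R : R)) ^+ 2)) ^+ k.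
Proof.
move=> apos g0 hg; elim: k => [|k IH] kn.
  rewrite expr0 mulr1 evec_pred1_rec // addr0 /evec_pred evecE //=.
  by rewrite mulr1.
rewrite evec_pred1_rec // rmorphD rmorphM /= exprS mulrCA.
apply: (@le_trans _ _ (2 * (a k.+2)%:~R * (evec_pred a k.+2).1%:~R)).
  have vm : (evec_pred a k.+1).1%:~R <= (evec_pred a k.+2).1%:~R :> R.
    by rewrite ler_int evec_pred1_mono.
  have : 1 <= (a k.+2)%:~R :> R by rewrite -[1]/(1%:~R) ler_int; exact: apos.
  have : 0 <= (evec_pred a k.+2).1%:~R :> R by rewrite ler0z; apply/ltW/evec_pred1_gt0.
  by nra.
apply: ler_pM.
- by rewrite mulr_ge0 // ler0z ltW // apos.
- by rewrite ler0z; apply/ltW/evec_pred1_gt0.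
- rewrite ler_pM2l //; apply: (le_trans (hg k.+2 isT)).
  rewrite ler_expR -!mulrA ler_pM2l //; apply: ler_pM => //.
  + by rewrite exprn_ge0 // ln_ge0 // ler1n.
  + by rewrite ler_nat.
  have l0 : 0 <= ln (k.+2%:R : R) by rewrite ln_ge0 // ler1n.
  have : ln (k.+2%:R : R) <= ln n%:R.
    by rewrite ler_ln ?posrE ?ltr0n ?ler_nat // (leq_trans _ kn).
  by move=> ll; rewrite lerXn2r ?nnegrE // (le_trans l0).
- exact/IH/ltnW.
Qed.

Lemma ln2_bounds (R : realType) : 1 / 2 <= ln (2 : R) <= 1.
Proof.
apply/andP; split; last first.
  by have := @le_ln1Dx R 1; rewrite (_ : 1 + 1 = 2); [apply; lra|ring].
have : ln (1 + (- (1 / 2)) : R) <= - (1 / 2) by apply: le_ln1Dx; lra.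
have -> : 1 + (- (1 / 2)) = (2 : R)^-1 by field.
by rewrite lnV ?posrE //; lra.
Qed.

Lemma lnln_ge (R : realType) (x : R) : 100 < x -> 3 <= ln x /\ 1 / 2 <= ln (ln x).
Proof.
move=> x100; have /andP[l2 _] := ln2_bounds R.
have lx : 3 <= ln x.
  apply: (@le_trans _ _ (ln (2 ^+ 6))).
    by rewrite lnXn // -mulr_natr; lra.
  rewrite ler_ln ?posrE ?exprn_gt0 //; last by lra.
  by rewrite -natrX; apply: ltW; apply: le_lt_trans x100; rewrite ler_nat.
split=> //; apply: (le_trans l2).
by rewrite ler_ln ?posrE //; lra.
Qed.

Lemma succn_leq_sqr (k : nat) : (2 <= k)%N -> (k.+1 <= k ^ 2)%N.
Proof. by rewrite -mulnn; nia. Qed.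

Lemma sqrt_ln_growth (R : realType) (a : nat -> int) (gamma : R) :
  (forall j, (0 < j)%N -> 0 < a j) -> 0 < gamma ->
  (forall k : nat, (2 <= k)%N ->
     (a k)%:~R <= expR (gamma * k%:R * (ln (k%:R : R)) ^+ 2)) ->
  exists2 C : R, 0 < C & forall (x : R) (k : nat), (4 <= k)%N -> 100 < x ->
    x <= (evec_pred a k.+2).1%:~R -> Num.sqrt (ln x) / ln (ln x) <= C * k%:R.
Proof.
move=> apos g0 hg.
have a1 : 0 <= ln (a 1)%:~R :> R.
  by rewrite ln_ge0 // -[1]/(1%:~R) ler_int; exact: apos.
(* The 1 pays for k ln 2; the 8 comes from k + 1 <= 2k and ln (k + 1) <= 2 ln k. *)
pose D : R := ln (a 1)%:~R + 1 + 8 * gamma.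
have D0 : 1 <= D by rewrite /D; lra.
exists (2 * D) => [|x k k4 x100 xv]; first by lra.
have [lx llx] := lnln_ge x100; have /andP[l2 l2'] := ln2_bounds R.
have k4' : 4 <= k%:R :> R by rewrite ler_nat.
have lk : 1 <= ln k%:R :> R.
  apply: (@le_trans _ _ (ln (2 ^+ 2))); first by rewrite lnXn // [leRHS]mulr2n; lra.
  by rewrite ler_ln ?posrE ?exprn_gt0 // -?natrX ?ler_nat ?ltr0n // (leq_trans _ k4).
have lk1 : ln k.+1%:R <= 2 * ln k%:R :> R.
  have -> : 2 * ln k%:R = ln (k%:R ^+ 2) :> R.
    by rewrite lnXn ?mulr_natl // ltr0n (leq_trans _ k4).
  rewrite ler_ln ?posrE ?exprn_gt0 ?ltr0n ?(leq_trans _ k4) // -natrX ler_nat.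
  by apply: succn_leq_sqr; apply: leq_trans k4.
have lnx : ln x <= D * (k%:R * ln k%:R) ^+ 2.
  apply: (@le_trans _ _ (ln ((a 1)%:~R
    * (2 * expR (gamma * k.+1%:R * (ln (k.+1%:R : R)) ^+ 2)) ^+ k))).
    have vv := evec_pred1_growth apos g0 hg (ltnSn k).
    rewrite ler_ln ?posrE //; [exact: le_trans vv|by lra|].
    by apply: lt_le_trans (le_trans xv vv); lra.
  rewrite lnM ?posrE ?exprn_gt0 ?mulr_gt0 ?expR_gt0 ?ltr0z ?apos //.
  rewrite lnXn ?mulr_gt0 ?expR_gt0 // lnM ?posrE ?expR_gt0 // expRK -[(_ + _) *+ k]mulr_natr.
  have lk10 : 0 <= ln k.+1%:R :> R by rewrite ln_ge0 // ler1n.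
  have sq : (ln k.+1%:R : R) ^+ 2 <= 4 * (ln k%:R) ^+ 2 by nra.
  have kl : k%:R <= (k%:R * ln k%:R) ^+ 2 :> R.
    have : k%:R <= k%:R * ln k%:R :> R by rewrite ler_peMr.
    by move: (k%:R * ln k%:R : R) => M; nra.
  have k1 : (k.+1%:R : R) <= 2 * k%:R by rewrite -natr1; lra.
  have : (k.+1%:R : R) * (ln k.+1%:R) ^+ 2 * k%:R <= 8 * (k%:R * ln k%:R) ^+ 2.
    rewrite exprMn.
    apply: (@le_trans _ _ ((2 * k%:R) * (4 * ln k%:R ^+ 2) * k%:R)).
      apply: ler_wpM2r => //; apply: ler_pM => //; exact: sqr_ge0.
    by rewrite le_eqVlt; apply/orP; left; apply/eqP; ring.
  move=> N8; have gN := ler_wpM2l (ltW g0) N8.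
  have M1 : 1 <= (k%:R * ln k%:R) ^+ 2 :> R by apply: le_trans kl; lra.
  have aM : ln (a 1)%:~R <= ln (a 1)%:~R * (k%:R * ln k%:R) ^+ 2 :> R by rewrite ler_peMr.
  have k2 : ln 2 * k%:R <= k%:R :> R by rewrite ler_piMl.
  by rewrite /D; lra.
have sx : Num.sqrt (ln x) <= D * (k%:R * ln k%:R).
  have kl0 : 0 <= k%:R * ln k%:R :> R by rewrite mulr_ge0 // (le_trans _ lk).
  rewrite -[leRHS]ger0_norm -?sqrtr_sqr; last by rewrite mulr_ge0 //; lra.
  apply: ler_wsqrtr; apply: (le_trans lnx); rewrite [leRHS]exprMn.
  apply: ler_wpM2r; first exact: sqr_ge0.
  by rewrite expr2 ler_peMr //; apply: le_trans D0.
have k0 : 0 <= k%:R :> R by [].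
rewrite ler_pdivrMr; last by lra.
(* If ln x <= k, its square root is at most k and ln ln x >= 1/2 suffices; otherwise ln ln x exceeds
   ln k and cancels that factor. *)
have [lek|ltk] := leP (ln x) k%:R.
  apply: (@le_trans _ _ k%:R); last first.
    have := ler_pM (_ : 0 <= 1) (_ : 0 <= 1/2) D0 llx; nra.
  apply: (@le_trans _ _ (Num.sqrt (k%:R ^+ 2))); last by rewrite sqrtr_sqr ger0_norm.
  by apply: ler_wsqrtr; nra.
have : ln k%:R <= ln (ln x) by rewrite ler_ln ?posrE //; lra.
move=> h; apply: (le_trans sx).
have -> : 2 * D * k%:R * ln (ln x) = D * (k%:R * (2 * ln (ln x))) by ring.
rewrite ler_pM2l; last lra.
by rewrite ler_wpM2l //; lra.
Qed.

(** * The theorem: choice of the index for a given q *)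

Theorem theorem1 (R : realType) (p : int * int -> nat) (X Y : nat -> int)
    (alpha : R) (a : nat -> int) (W : nat -> nat)
    (lam : nat -> int) (Z : nat -> int * int) :
  prime_indexing p ->
  crt_solutions p X Y ->
  irrational alpha ->
  is_cfrac_expansion alpha a ->
  (forall k : nat, (0 < W k)%N) ->
  ((W k)%:R : R) @[k --> \oo] --> +oo ->
  (forall k : nat, ((Pk p k./2)%:Z %| a k.+1)%Z) ->
  (forall k : nat, (W k)%:Z * (Pk p k./2.+1)%:Z <= a k.+1) ->
  (exists2 gamma : R, 0 < gamma &
     forall k : nat, (2 <= k)%N ->
       (a k)%:~R <= expR (gamma * k%:R * (ln (k%:R : R)) ^+ 2)) ->
  point_construction p a X Y lam Z ->
  let u : nat -> R := fun k => (Z k).1%:~R * alpha - (Z k).2%:~R in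
  let eta : R := limn u in
  cvgn u /\
  exists2 c : R, 0 < c &
    forall q r : int, coprimez q r -> 100 < q ->
      c * (Num.sqrt (ln (q%:~R : R)) / ln (ln (q%:~R : R)))
        < q%:~R * `|q%:~R * alpha - eta - r%:~R|.
Proof.
move=> hp hcrt _ hcf W0 Wcvg _ ha [gamma g0 hg] hZ u eta.
have apos := hcf.1.
have [ucvg _] := partial_form_cvg hp hcf W0 ha hZ; split=> //.
have [C C0 hC] := sqrt_ln_growth apos g0 hg.
have [N hN] : exists N, forall n, (N <= n)%N -> (60 <= W n)%N.
  have [N _ hN] := (cvgryPge (fun k => (W k)%:R : R)).1 Wcvg 60.
  by exists N => n Nn; rewrite -(ler_nat R); exact: hN.
pose K := maxn N 3.
pose V n : R := (evec_pred a n).1%:~R.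
have V0 n : 0 < V n.+1 by rewrite ltr0z evec_pred1_gt0.
have main (k : nat) (q r : int) : (K <= k)%N -> coprimez q r -> 100 < q ->
    8 * q%:~R <= V k.+3 ->
    V k.+2 * `|q%:~R * alpha - eta - r%:~R| <= k.+1%:R ->
    k.+1%:R / 400 <= q%:~R * `|q%:~R * alpha - eta - r%:~R|.
  rewrite geq_max => /andP[Nk _] cop q100 qv vL.
  apply: (form_ge_index hp hcrt hcf W0 ha hZ) => //; first exact: lt_trans q100.
    exact: hN.
  by apply: hN; exact: leqW.
(* 1/400 comes from [form_ge_index]; the second entry serves the small q, all treated at the index
   K. *)
pose c0 : R := Num.min (1 / 400) (V K.+2)^-1.
have c00 : 0 < c0 by rewrite lt_min invr_gt0 V0 andbT; lra.
have c01 : c0 <= 1 / 400 by rewrite ge_min lexx.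
have c02 : c0 <= (V K.+2)^-1 by rewrite ge_min lexx orbT.
exists (c0 / (2 * C)) => [|q r cop q100]; first by rewrite divr_gt0 // mulr_gt0.
set L := `|q%:~R * alpha - eta - r%:~R|.
have L0 : 0 <= L by exact: normr_ge0.
have q100' : 100 < q%:~R :> R by rewrite -[100]/(100%:~R) ltr_int.
(* The 2 in c0 / (2C) makes the final inequality strict; K >= 3 gives the k + 1 >= 4 that
   [sqrt_ln_growth] asks for. *)
suff [k [Kk qv kL]] : exists k, [/\ (K <= k)%N, 8 * q%:~R <= V k.+3
    & c0 * k.+1%:R <= q%:~R * L].
  have k3 : (4 <= k.+1)%N by rewrite ltnS (leq_trans _ Kk) // leq_maxr.
  have := hC q%:~R k.+1 k3 q100'; rewrite -/(V _) => /(_ _) hS.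
  have {}hS : Num.sqrt (ln q%:~R) / ln (ln q%:~R) <= C * k.+1%:R by apply: hS; lra.
  have cC : 0 < c0 / (2 * C) by rewrite divr_gt0 // mulr_gt0.
  apply: (le_lt_trans (ler_wpM2l (ltW cC) hS)); apply: lt_le_trans kL.
  have -> : c0 / (2 * C) * (C * k.+1%:R) = c0 * k.+1%:R / 2.
    by field; exact: lt0r_neq0.
  have : 0 < c0 * k.+1%:R by rewrite mulr_gt0 // ltr0n.
  by lra.
have [qK|qK] := leP (8 * q%:~R) (V K.+3).
  exists K; split=> //; have [vL|vL] := leP (V K.+2 * L) K.+1%:R.
    apply: le_trans (main K q r (leqnn K) cop q100 qK vL).
    by rewrite mulrC ler_wpM2l //; lra.
  apply: (@le_trans _ _ L); last by rewrite ler_peMl //; lra.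
  apply: (@le_trans _ _ ((V K.+2)^-1 * K.+1%:R)); first exact: ler_wpM2r.
  by rewrite mulrC ler_pdivrMr // mulrC ltW.
(* For larger q, the first denominator reaching 8q fixes the window. *)
have [k []] : exists k, [/\ (K <= k)%N, V k.+3 < 8 * q%:~R & 8 * q%:~R <= V k.+4].
  have exn : exists n, 8 * q%:~R <= V (K + n).+3.
    exists (absz (8 * q)); rewrite /V -[8]/(8%:~R) -rmorphM ler_int.
    apply: le_trans (evec_pred1_ge _ apos); apply: (le_trans (ler_norm _)).
    by rewrite -abszE lez_nat !leqW // leq_addl.
  case: (ex_minnP exn) => -[|m]; first by rewrite addn0 leNgt qK.
  rewrite addnS => vm mmin; exists (K + m)%N; split=> //; first exact: leq_addr.
  by rewrite ltNge; apply/negP => /mmin; rewrite ltnn.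
move=> Kk vq qv; exists k.+1; split=> //; first exact: leqW.
have [vL|vL] := leP (V k.+3 * L) k.+2%:R.
  apply: le_trans (main k.+1 q r (leqW Kk) cop q100 qv vL).
  by rewrite mulrC ler_wpM2l //; lra.
(* When v_(k+2) |L| > k + 2, the lower end of the window alone gives q |L| > (k + 2) / 8. *)
have : V k.+3 * L <= 8 * q%:~R * L by rewrite ler_wpM2r // ltW.
have : c0 * k.+2%:R <= 1 / 400 * k.+2%:R by rewrite ler_wpM2r.
by have : 0 <= k.+2%:R :> R by []; lra.
Qed.
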